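(* Let $p$ be a prime, let $r\geq 1$ and $t\geq 1$ be integers with $\gcd(p^r-1,t)=1$, and let $n=p^r+t$. Let $\mathcal{P}$ be a nonempty monotone and non-evasive property of graphs on $n$ vertices. Then $\mathcal{P}$ contains at least one of the following graphs: $K_{p^r}\cup\overline{K}_t$; $K_{p^r,t}$; or one of the graphs of the form $\overline{K}_{p^r}\cup G$, where $G$ is a graph with at least one edge on the $t$ vertices $p^r+1,\ldots,n$ that is fixed under the action of $\mathbb{Z}/t$ which permutes these $t$ vertices cyclically.
   Context: Graphs are finite and simple. A graph property $\mathcal{P}$ on $n$ vertices is a collection of graphs with vertex set $\{1,\ldots,n\}$ (identified with their edge sets) that is closed under isomorphism of graphs. Its complexity $c(\mathcal{P})$ is the minimum $k$ such that some adaptive strategy of questions of the form ''is $\{i,j\}$ an edge of $G$?'' always determines, for every unknown graph $G$ on $\{1,\ldots,n\}$, whether $G\in\mathcal{P}$ using at most $k$ questions. $\mathcal{P}$ is evasive if $c(\mathcal{P})=\binom{n}{2}$, and non-evasive otherwise. $\mathcal{P}$ is monotone if it is closed under removal of edges. $K_m$ is the complete graph on $m$ vertices, $\overline{K}_m$ is the graph on $m$ vertices with no edges, $K_{a,b}$ is the complete bipartite graph, and $G_1\cup G_2$ denotes the disjoint union of graphs. A graph on the $t$ vertices $p^r+1,\ldots,n$ is fixed under the action of $\mathbb{Z}/t$ if it is invariant under the cyclic permutation $(p^r+1\ \ p^r+2\ \cdots\ n)$. *)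

(* Defs.v *)
From mathcomp Require Import all_boot perm.
From mathcomp Require Import boolp.

Set Implicit Arguments.
Unset Strict Implicit.
Unset Printing Implicit Defensive.

(* The vertex set {1, ..., n} is rendered as 'I_n = {0, ..., n-1}. *)

Definition edge (n : nat) : finType := {e : {set 'I_n} | #|e| == 2}.

Definition graph (n : nat) : finType := {set edge n}.

Lemma map_edge_subproof (m n : nat) (f : 'I_m -> 'I_n) (fI : injective f)
  (e : edge m) : #|f @: val e| == 2.
Proof. by rewrite card_imset //; exact: (valP e). Qed.

Definition map_edge (m n : nat) (f : 'I_m -> 'I_n) (fI : injective f)
  (e : edge m) : edge n := exist _ (f @: val e) (map_edge_subproof fI e).

Definition map_graph (m n : nat) (f : 'I_m -> 'I_n) (fI : injective f)
  (G : graph m) : graph n := [set map_edge fI e | e in G].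

Definition isomorphic (n : nat) (G H : graph n) : Prop :=
  exists s : 'S_n, H = map_graph (@perm_inj _ s) G.

Definition graph_property (n : nat) (P : {set graph n}) : Prop :=
  forall G H : graph n, isomorphic G H -> G \in P -> H \in P.

Definition monotone_property (n : nat) (P : {set graph n}) : Prop :=
  forall G H : graph n, H \subset G -> G \in P -> H \in P.

Inductive strategy (n : nat) : Type :=
| Answer of bool
| Ask of edge n & strategy n & strategy n. (* continuations for yes, no *)

Fixpoint answer (n : nat) (T : strategy n) (G : graph n) : bool :=
  match T with
  | Answer b => b
  | Ask e Ty Tn => if e \in G then answer Ty G else answer Tn G
  end.

Fixpoint questions (n : nat) (T : strategy n) (G : graph n) : nat :=
  match T with
  | Answer _ => 0
  | Ask e Ty Tn => (if e \in G then questions Ty G else questions Tn G).+1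
  end.

Definition decidable_within (n : nat) (P : {set graph n}) (k : nat) : Prop :=
  exists T : strategy n,
    forall G : graph n, answer T G = (G \in P) /\ questions T G <= k.

Lemma exists_decidable_within (n : nat) (P : {set graph n}) :
  exists k, `[< decidable_within P k >].
Proof.
exists #|edge n|; apply/asboolP.
pose ask := fix ask (s : seq (edge n)) (A : graph n) : strategy n :=
  if s is e :: s' then Ask e (ask s' (e |: A)) (ask s' A)
  else Answer n (A \in P).
have askP s A G : answer (ask s A) G = (A :|: (G :&: [set:: s]) \in P)
    /\ questions (ask s A) G = size s.
  elim: s A => [|e s IHs] A /=; first by rewrite set_nil setI0 setU0.
  case: ifPn => eG.
    have [-> ->] := IHs (e |: A); split=> //; congr (_ \in P).
    apply/setP=> x; rewrite !inE.
    by case: eqP => [->|_]; rewrite ?eG //= ?orbT.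
  have [-> ->] := IHs A; split=> //; congr (_ \in P).
  apply/setP=> x; rewrite !inE.
  by case: eqP => [->|_] //=; rewrite (negPf eG).
exists (ask (enum (edge n)) set0) => G.
have [-> ->] := askP (enum (edge n)) set0 G.
rewrite -cardE leqnn set0U; split=> //; congr (_ \in P).
by apply/setP=> e; rewrite !inE mem_enum andbT.
Qed.

Definition complexity (n : nat) (P : {set graph n}) : nat :=
  ex_minn (exists_decidable_within P).

Definition evasive (n : nat) (P : {set graph n}) : Prop :=
  complexity P = 'C(n, 2).

Definition complete_graph (m : nat) : graph m := setT.

Definition empty_graph (m : nat) : graph m := set0.

Definition complete_bipartite (a b : nat) : graph (a + b) :=
  [set e : edge (a + b) | [exists i : 'I_a, exists j : 'I_b,
                             val e == [set lshift b i; rshift a j]]].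

(* The vertices of G1 come first: vertex j of G2 becomes a + j. *)
Definition disjoint_union (a b : nat) (G1 : graph a) (G2 : graph b) :
    graph (a + b) :=
  map_graph (@lshift_inj a b) G1 :|: map_graph (@rshift_inj a b) G2.

(* ordS is the cycle i |-> i + 1 mod t, a generator of the Z/t-action. *)
Definition cyclic_fixed (t : nat) (G : graph t) : Prop :=
  map_graph (@ordS_inj t) G = G.

(* Main.v *)
(* As in Kahn, Saks and Sturtevant, a decision tree asking fewer than C(n, 2)
   questions shows that the poset of nonempty graphs in P, ordered by inclusion,
   has an acyclic order complex. Let F be the field with p ^ r elements, which
   also serves as coefficient field. The translations of F act on the first
   p ^ r vertices and have order p, so by Smith theory the graphs fixed by all
   of them still form an acyclic poset. It is preserved by the permutation that
   multiplies the first p ^ r vertices by a generator of F^* and rotates the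
   last t vertices, so by the Lefschetz fixed point theorem P contains a nonempty
   graph invariant under this permutation and under the translations. Such a
   graph is a union of orbits of edges: the edges inside F form a single orbit,
   and so do the edges between F and the last t vertices. *)
From HB Require Import structures.
Require Import Defs.
From mathcomp Require Import all_boot all_order all_algebra.
From mathcomp Require Import fingroup perm cyclic finfield ring boolp fingraph.

Set Implicit Arguments.
Unset Strict Implicit.
Unset Printing Implicit Defensive.

Import Order.TTheory GRing.Theory.

(** * Orbits of a map of prime order *)

Section PrimeOrbits.

Variables (F : fieldType) (p : nat) (I : finType) (s : I -> I).
Hypotheses (p_pr : prime p) (sp : forall x, iter p s x = x).

Local Open Scope ring_scope.

Lemma iterp_inj : injective s.
Proof. by apply: (can_inj (g := iter p.-1 s)) => x; rewrite -iterSr prednK ?prime_gt0. Qed.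

Lemma order_prime x : s x != x -> order s x = p.
Proof.
move=> sx; pose m := order s x.
have m_gt0 : (0 < m)%N by exact: order_gt0.
have itm k : iter (k * m) s x = x.
  by elim: k => // k IHk; rewrite mulSn iterD IHk iter_order //; exact: iterp_inj.
have pm : (m %| p)%N.
  (* Below the order [findex] recovers the exponent, so [iter (p %% m) s x = x] forces [p %% m] to
     be 0. *)
  rewrite /dvdn -(findex_iter (ltn_pmod p m_gt0)) (_ : iter _ s x = x) ?findex0 //.
  by rewrite -[RHS]sp {2}(divn_eq p m) addnC iterD itm.
apply/(prime_nt_dvdP p_pr) => //.
by apply: contra sx => /eqP m1; rewrite -[X in _ == X](itm 1%N) mul1n /m m1.
Qed.

Lemma sum_iter_orbit (f : I -> F) x : s x != x ->
  \sum_(i < p) f (iter i s x) = \sum_(y in fconnect s x) f y.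
Proof.
move=> sx; rewrite -[RHS]big_enum /=.
rewrite (perm_big (orbit s x)); last first.
  apply: uniq_perm; rewrite ?enum_uniq ?orbit_uniq // => y.
  by rewrite mem_enum -fconnect_orbit.
rewrite /orbit order_prime // -(big_mkord xpredT (fun i => f (iter i s x))).
rewrite [RHS](big_nth x) size_traject; apply: eq_big_nat => i /andP[_ ip].
by rewrite nth_traject.
Qed.

(** On a free orbit an invariant function is a norm: [g] puts the whole value at the root of the
    orbit and 0 elsewhere. *)
Lemma invariant_sum_orbit (f : I -> F) : (forall x, f (s x) = f x) ->
  exists g : I -> F, forall x, s x != x -> f x = \sum_(i < p) g (iter i s x).
Proof.
move=> fs; pose g x := if froot s x == x then f x else 0; exists g => x sx.
have fsC : connect_sym (frel s) by exact: fconnect_sym iterp_inj.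
rewrite sum_iter_orbit // /g (bigD1 (froot s x)) /=; last exact: connect_root.
rewrite root_root // eqxx big1 ?addr0 => [|y /andP[xy yr]]; last first.
  by rewrite -(fingraph.rootP fsC xy) eq_sym (negPf yr).
rewrite -(iter_findex (connect_root (frel s) x)).
by elim: findex => //= n ->; rewrite fs.
Qed.

(** Discrete integration: [g] is minus the partial sum of [f] from the root of the orbit up to, but
    excluding, the point. *)
Lemma sum_orbit0_boundary (f : I -> F) :
    (forall x, \sum_(i < p) f (iter i s x) = 0) ->
  exists g : I -> F, forall x, s x != x -> f x = g x - g (s x).
Proof.
move=> f0; pose G r n := \sum_(j < n) f (iter j s r).
exists (fun x => - G (froot s x) (findex s (froot s x) x)) => x sx.
have fsC : connect_sym (frel s) by exact: fconnect_sym iterp_inj.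
have -> : froot s (s x) = froot s x by apply/esym/(fingraph.rootP fsC); exact: fconnect1.
set r := froot s x; have rx : fconnect s r x by rewrite fsC; exact: connect_root.
have iE := iter_findex rx; have ip := findex_max rx.
have sr : s r != r.
  apply: contra sx => /eqP sr.
  have fixr n : iter n s r = r by elim: n => //= n ->.
  by rewrite -iE fixr sr.
rewrite (order_prime sr) in ip; set i := findex s r x in iE ip *.
have [ltip|leip] := ltnP i.+1 p.
  rewrite -iE -iterS findex_iter ?order_prime // /G big_ord_recr /=.
  by rewrite opprK addKr.
(* At the end of the orbit [s x] is the root again, where the partial sum is empty; the vanishing of
   the total closes the gap. *)
have pE : i.+1 = p by apply/eqP; rewrite eqn_leq leip ip.
have -> : s x = r by rewrite -iE -iterS pE sp.
rewrite findex0 /G big_ord0 oppr0 subr0; apply/eqP.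
by have := f0 r; rewrite -pE big_ord_recr /= iE addrC => /eqP; rewrite addr_eq0.
Qed.

End PrimeOrbits.

(** * The order complex of a finite poset *)

Section OrderComplex.

Variables (F : fieldType) (disp : Order.disp_t) (X : finPOrderType disp).

Local Open Scope ring_scope.

Implicit Types (Y : {set X}) (c : {set X}) (x y z : X) (s : X -> X)
  (K : {set {set X}}).

Local Notation C := {ffun {set X} -> F^o}.

Definition is_chain c := [forall x in c, forall y in c, (x >=< y)%O].

Definition chains Y : {set {set X}} := [set c | is_chain c & c \subset Y].

Definition supp_in (K : {set {set X}}) (f : C) := forall c, c \notin K -> f c = 0.

(* Chains are oriented by the order of X, so that order automorphisms act on them
   without signs. *)
Definition sgn x c : F := (-1) ^+ #|[set y in c | (y < x)%O]|.

(** The simplicial boundary read coefficientwise: [c] collects the coefficients of the sets of which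
    it is a facet. *)
Definition bd (f : C) : C :=
  [ffun c : {set X} => \sum_(x | x \notin c) sgn x c * f (x |: c)].

(** The empty set counts as a chain, so this says that reduced homology vanishes; the empty poset is
    not acyclic. *)
Definition acyclic Y := forall f, supp_in (chains Y) f -> bd f = 0 ->
  exists2 g, supp_in (chains Y) g & f = bd g.

Definition wpull (a : {set X} -> F) (phi : {set X} -> {set X}) (f : C) : C :=
  [ffun c => a c * f (phi c)].

Fact bd_linear : linear bd.
Proof.
move=> k f g; apply/ffunP => c; rewrite !ffunE scaler_sumr -big_split /=.
apply: eq_bigr => x _; rewrite !ffunE mulrDr; congr (_ + _).
by rewrite /GRing.scale /= mulrCA.
Qed.
HB.instance Definition _ := GRing.isLinear.Build F C C *:%R bd bd_linear.

Fact wpull_linear a phi : linear (wpull a phi).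
Proof.
move=> k f g; apply/ffunP => c; rewrite !ffunE mulrDr; congr (_ + _).
by rewrite /GRing.scale /= mulrCA.
Qed.
HB.instance Definition _ a phi :=
  GRing.isLinear.Build F C C *:%R (wpull a phi) (wpull_linear a phi).

Lemma chainP c : reflect {in c &, forall x y, (x >=< y)%O} (is_chain c).
Proof.
apply: (iffP forall_inP) => [H x y xc yc|H x xc]; last by apply/forall_inP=> y; exact: H.
by have /forall_inP := H x xc; apply.
Qed.

Lemma chainS c c' : c \subset c' -> is_chain c' -> is_chain c.
Proof. by move=> /subsetP cc' /chainP H; apply/chainP => x y /cc' ? /cc'; exact: H. Qed.

Lemma chainsS Y c c' : c \subset c' -> c' \in chains Y -> c \in chains Y.
Proof.
by move=> cc'; rewrite !inE => /andP[/(chainS cc') -> /(subset_trans cc') ->].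
Qed.

Lemma chainsP Y c : reflect (is_chain c /\ c \subset Y) (c \in chains Y).
Proof. by rewrite inE; exact: andP. Qed.

Lemma suppP K (f : C) c : supp_in K f -> f c != 0 -> c \in K.
Proof. by move=> Kf; apply: contraR => /Kf ->. Qed.

Lemma supp_bd Y f : supp_in (chains Y) f -> supp_in (chains Y) (bd f).
Proof.
move=> Yf c cY; rewrite ffunE big1 // => x _; rewrite Yf ?mulr0 //.
by apply: contra cY; apply: chainsS; exact: subsetUr.
Qed.

Lemma suppB K f g : supp_in K f -> supp_in K g -> supp_in K (f - g).
Proof. by move=> Kf Kg c cK; rewrite !ffunE Kf // Kg // subrr. Qed.

Lemma suppD K f g : supp_in K f -> supp_in K g -> supp_in K (f + g).
Proof. by move=> Kf Kg c cK; rewrite !ffunE Kf // Kg // addr0. Qed.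

Lemma sgnU x y c : y \notin c -> sgn x (y |: c) = (-1) ^+ (y < x)%O * sgn x c.
Proof.
move=> yc; rewrite /sgn -exprD; congr (_ ^+ _).
case: (boolP (y < x)%O) => yx.
  have -> : [set z in y |: c | (z < x)%O] = y |: [set z in c | (z < x)%O].
    by apply/setP=> z; rewrite !inE; case: eqVneq => // ->.
  by rewrite cardsU1 !inE (negPf yc).
congr #|pred_of_set _|; apply/setP=> z; rewrite !inE.
by case: eqVneq => // ->; rewrite (negPf yx) (negPf yc).
Qed.

(** The two orders of inserting a pair of comparable points carry opposite signs; sets with an
    incomparable pair lie outside the support of [f]. *)
Lemma bd_bd Y f : supp_in (chains Y) f -> bd (bd f) = 0.
Proof.
move=> Yf; apply/ffunP => c; rewrite !ffunE.
under eq_bigr => x _ do rewrite ffunE mulr_sumr.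
rewrite (pair_big_dep (fun x => x \notin c)) /=.
pose G x y := sgn x c * (sgn y (x |: c) * f (y |: (x |: c))).
pose Q (u : X * X) := (u.1 \notin c) && (u.2 \notin u.1 |: c).
rewrite (eq_bigr (fun u => G u.1 u.2)) // (eq_bigl Q) //.
rewrite (bigID (fun u : X * X => (u.1 < u.2)%O)) /=.
rewrite [X in _ + X](bigID (fun u : X * X => (u.2 < u.1)%O)) /=.
rewrite [X in _ + (_ + X)]big1 ?addr0; last first.
  move=> [x y] /= /andP[/andP[]]; rewrite /Q !inE negb_or /=.
  case/and3P=> xc yx yc xy yx'; rewrite /G Yf ?mulr0 //.
  apply/negP=> /chainsP[/chainP/(_ x y)]; rewrite !inE !eqxx ?orbT => /(_ isT isT).
  by rewrite /Order.comparable !le_eqVlt (negPf xy) (negPf yx') eq_sym (negPf yx).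
rewrite [X in _ + X](reindex (fun u : X * X => (u.2, u.1))) /=; last first.
  by exists (fun u : X * X => (u.2, u.1)) => -[].
rewrite [X in _ + X](eq_bigl (fun u => Q u && (u.1 < u.2)%O)); last first.
  case=> x y; rewrite /Q /= !inE !negb_or [y == x]eq_sym.
  have [xy|] := boolP (x < y)%O; last by rewrite !andbF.
  by rewrite lt_gtF // !andbT; case: (x \in c); case: (y \in c); rewrite ?andbF.
rewrite -big_split big1 //= => -[x y] /= /andP[/andP[/= xc]].
rewrite !inE negb_or => /andP[yx yc] xy; rewrite /G [y |: (x |: c)]setUCA.
rewrite !sgnU // xy (lt_gtF xy) /=; ring.
Qed.

(** * Deleting a point: links, cones and closure maps *)

Definition cosgn y c : F := (-1) ^+ #|[set x in c | (y < x)%O]|.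

Lemma cosgnU x y c : x \notin c -> cosgn y (x |: c) = (-1) ^+ (y < x)%O * cosgn y c.
Proof.
move=> xc; rewrite /cosgn -exprD; congr (_ ^+ _).
case: (boolP (y < x)%O) => yx.
  have -> : [set z in x |: c | (y < z)%O] = x |: [set z in c | (y < z)%O].
    by apply/setP=> z; rewrite !inE; case: eqVneq => // ->.
  by rewrite cardsU1 !inE (negPf xc).
congr #|pred_of_set _|; apply/setP=> z; rewrite !inE.
by case: eqVneq => // ->; rewrite (negPf yx) (negPf xc).
Qed.

Definition link Y y : {set X} := [set x in Y | (x != y) && (x >=< y)%O].

(** The quotient of the complex of [Y] by that of [Y :\ y], identified with the complex of the link
    of [y] shifted by one degree; [of_link] is a section. *)
Definition to_link y : C -> C :=
  wpull (fun c => if y \in c then 0 else cosgn y c) (fun c => y |: c).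
HB.instance Definition _ y := GRing.Linear.on (to_link y).

Definition of_link y : C -> C :=
  wpull (fun c => if y \in c then cosgn y (c :\ y) else 0) (fun c => c :\ y).

(** As [cosgn] counts the points above [y] and [sgn] those below [x], both sides acquire the same
    sign (-1)^(y < x), and the maps commute rather than anticommute. *)
Lemma bd_to_link y f : bd (to_link y f) = to_link y (bd f).
Proof.
apply/ffunP => c; rewrite !ffunE; have [yc|yc] := boolP (y \in c).
  rewrite mul0r big1 // => x _.
  by rewrite ffunE in_setU yc orbT mul0r mulr0.
rewrite (bigD1 y) //= ffunE in_setU in_set1 eqxx mul0r mulr0 add0r mulr_sumr.
apply: eq_big => [x|x /andP[xc xy]].
  by rewrite !inE negb_or andbC.
rewrite ffunE !inE eq_sym (negPf xy) (negPf yc) /= cosgnU // sgnU // setUCA.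
ring.
Qed.

Lemma supp_to_link Y y f : y \in Y -> supp_in (chains Y) f ->
  supp_in (chains (link Y y)) (to_link y f).
Proof.
move=> yY Yf c; apply: contraNeq; rewrite ffunE.
case: ifPn => [_|yc]; first by rewrite mul0r eqxx.
rewrite mulf_eq0 negb_or => /andP[_ /(suppP Yf)].
case/chainsP=> /chainP chc /subsetP cY; apply/chainsP; split.
  by apply/chainP=> a b ac bc; apply: chc; rewrite inE ?ac ?bc orbT.
apply/subsetP=> x xc; rewrite inE cY ?inE ?xc ?orbT //=.
rewrite (contraTneq _ xc) ?yc // => [|-> //].
by apply: chc; rewrite !inE ?eqxx ?xc ?orbT.
Qed.

Lemma supp_of_link Y y g : y \in Y -> supp_in (chains (link Y y)) g ->
  supp_in (chains Y) (of_link y g).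
Proof.
move=> yY Yg c; apply: contraNeq; rewrite ffunE.
case: ifPn => [yc|_]; last by rewrite mul0r eqxx.
rewrite mulf_eq0 negb_or => /andP[_ /(suppP Yg)].
case/chainsP=> /chainP chc /subsetP cY.
have cP x : x \in c -> x = y \/ [/\ x \in c :\ y, x \in Y & (x >=< y)%O].
  move=> xc; case: (eqVneq x y) => [->|xy]; [by left|right].
  have xc' : x \in c :\ y by rewrite !inE xy.
  by move/cY: (xc'); rewrite inE => /and3P[].
apply/chainsP; split; last by apply/subsetP=> x /cP[->|[]].
apply/chainP=> a b /cP[->|[ac _ ay]] /cP[->|[bc _ by_]] //.
- by rewrite comparablexx.
- by rewrite comparable_sym.
- exact: chc.
Qed.

Lemma of_linkK Y y g : supp_in (chains (link Y y)) g -> to_link y (of_link y g) = g.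
Proof.
move=> Yg; apply/ffunP => c; rewrite !ffunE.
have [yc|yc] := boolP (y \in c).
  rewrite mul0r Yg //; apply/chainsP => -[_ /subsetP/(_ _ yc)].
  by rewrite inE eqxx andbF.
by rewrite setU11 setU1K // mulrA /cosgn -expr2 sqrr_sign mul1r.
Qed.

Lemma to_link_eq0 Y y f : supp_in (chains Y) f -> to_link y f = 0 ->
  supp_in (chains (Y :\ y)) f.
Proof.
move=> Yf f0 c; apply: contraNeq => fc.
have /chainsP[chc cY] := suppP Yf fc.
apply/chainsP; split=> //; rewrite subsetD1 cY /=.
apply: contraNN fc => yc; have := congr1 (fun g : C => g (c :\ y)) f0.
by rewrite !ffunE !inE eqxx /= setD1K // => /eqP; rewrite mulf_eq0 signr_eq0.
Qed.

Lemma chains_mono Y Y' : Y \subset Y' -> chains Y \subset chains Y'.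
Proof.
move=> YY'; apply/subsetP=> c /chainsP[chc cY]; apply/chainsP; split=> //.
exact: subset_trans YY'.
Qed.

Lemma supp_mono K K' f : K \subset K' -> supp_in K f -> supp_in K' f.
Proof. by move=> /subsetP KK' Kf c cK; apply: Kf; apply: contra cK; exact: KK'. Qed.

(* A filling of the part of a cycle f seen in the link of y yields a boundary
   that agrees with f on the chains through y. *)
Lemma acyclic_link Y y : y \in Y -> acyclic (link Y y) -> acyclic (Y :\ y) ->
  acyclic Y.
Proof.
move=> yY acL acD f Yf df0.
have [|g Lg fg] := acL _ (supp_to_link yY Yf).
  by rewrite bd_to_link df0 linear0.
have Yg := supp_of_link yY Lg; have Ydg := supp_bd Yg.
have [||h Dh fh] := acD (f - bd (of_link y g)).
- apply: (to_link_eq0 (suppB Yf Ydg)).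
  by rewrite linearB /= -bd_to_link (of_linkK Lg) -fg subrr.
- by rewrite linearB /= df0 (bd_bd Yg) subrr.
exists (of_link y g + h); last by rewrite linearD /= -fh addrC subrK.
by apply: suppD => //; apply: supp_mono Dh; rewrite chains_mono ?subsetDl.
Qed.

(** A point has only the chains [set0] and [[set m]], and the boundary maps the second
    isomorphically to the first. *)
Lemma acyclic1 m : acyclic [set m].
Proof.
have mP c : c \notin chains [set m] -> c \notin [:: set0; [set m]].
  apply: contraNN; rewrite !inE => /orP[]/eqP->; rewrite ?sub0set ?subxx andbT.
    by apply/chainP => x y; rewrite inE.
  by apply/chainP => x y /set1P-> /set1P->; exact: comparablexx.
move=> f Yf df0; exists [ffun c : {set X} => if c == [set m] then f set0 else 0].
  by move=> c /mP; rewrite !inE negb_or ffunE => /andP[_ /negPf->].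
apply/ffunP => c; rewrite ffunE.
have [->|c0] := eqVneq c set0.
  rewrite (bigD1 m) ?inE //= ffunE setU0 eqxx /sgn.
  rewrite big1 => [|x /andP[_ xm]].
    have -> : [set y in set0 | (y < m)%O] = set0 by apply/setP=> y; rewrite !inE.
    by rewrite cards0 mul1r addr0.
  rewrite ffunE setU0; case: eqP => [/set1_inj/eqP|]; first by rewrite (negPf xm).
  by rewrite mulr0.
rewrite big1 => [|x xc]; last first.
  rewrite ffunE; case: eqP => [xm|]; last by rewrite mulr0.
  case/set0Pn: c0 => z zc.
  have := subsetUr [set x] c; rewrite xm => /subsetP/(_ _ zc)/set1P zm.
  have := subsetUl [set x] c; rewrite xm => /subsetP/(_ x); rewrite !inE eqxx.
  by move=> /(_ isT)/eqP xE; rewrite xE -zm zc in xc.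
have [->|cm] := eqVneq c [set m]; last first.
  by apply: Yf; apply: contra c0 => /chainsP[_]; rewrite subset1 (negPf cm).
have := congr1 (fun g : C => g set0) df0.
rewrite !ffunE (bigD1 m) ?inE //= setU0 big1 => [|x /andP[_ xm]].
  by rewrite addr0 => /eqP; rewrite mulf_eq0 signr_eq0 /= => /eqP.
rewrite setU0 Yf ?mulr0 //; apply/chainsP=> -[_].
by rewrite sub1set inE (negPf xm).
Qed.

(** Induction on the size of [Y]: for any [y] other than the apex, both the link and the deletion of
    [y] are smaller cones with apex [m]. *)
Lemma acyclic_cone Y m : m \in Y -> {in Y, forall x, (x >=< m)%O} -> acyclic Y.
Proof.
have [n] := ubnP #|Y|; elim: n => // n IHn in Y * => leYn mY mP.
have [YE|] := eqVneq Y [set m]; first by rewrite YE; exact: acyclic1.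
move=> Ym; have /subsetPn[y yY ym] : ~~ (Y \subset [set m]).
  apply: contra Ym => Ym; rewrite eqEsubset Ym sub1set //.
have ltY : (#|Y :\ y| < n)%N by move: leYn; rewrite (cardsD1 y) yY.
rewrite inE in ym; apply: (acyclic_link yY).
  apply: IHn => [||x].
  - apply: leq_ltn_trans ltY; apply: subset_leq_card; apply/subsetP=> x.
    by rewrite !inE => /and3P[-> ->].
  - by rewrite inE mY eq_sym ym comparable_sym mP.
  - by rewrite inE => /and3P[/mP].
apply: IHn => // [|x]; first by rewrite !inE eq_sym ym.
by rewrite inE => /andP[_ /mP].
Qed.

(* If y is minimal among the points moved by s, then its link is a cone with apex
   s y, so that y can be removed. *)
Lemma acyclic_closure Y s :
  {in Y, forall x, [/\ s x \in Y, s (s x) = s x & (s x <= x)%O]} ->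
  {in Y &, {homo s : x y / (x <= y)%O}} ->
  acyclic [set x in Y | s x == x] -> acyclic Y.
Proof.
have [n] := ubnP #|Y|; elim: n => // n IHn in Y * => leYn sY smono acF.
have [YF|] := eqVneq Y [set x in Y | s x == x]; first by rewrite YF.
move=> YF; have /subsetPn[y0 y0Y] : ~~ (Y \subset [set x in Y | s x == x]).
  apply: contra YF => YF; rewrite eqEsubset YF; apply/subsetP => x.
  by rewrite inE => /andP[].
rewrite inE y0Y /= => sy0.
pose Q x := (x \in Y) && (s x != x).
(* The number of points below grows strictly along the order, so its minimiser is minimal among the
   moved points. *)
have [|y /andP[yY sy] ymin] := @arg_minnP _ y0 Q (fun x => #|[set z in Y | (z < x)%O]|).
  exact/andP.
have lty z : z \in Y -> (z < y)%O -> s z = z.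
  move=> zY zy; apply/eqP; apply: contraT => sz.
  have /ymin : Q z by exact/andP.
  rewrite leqNgt => /negP[]; apply: proper_card; apply/properP; split.
    apply/subsetP=> x; rewrite !inE => /andP[-> /lt_trans]; exact.
  by exists z; rewrite !inE ?zY ?ltxx.
have [syY ssy sy_y] := sY y yY.
apply: (acyclic_link yY).
  apply: (@acyclic_cone _ (s y)) => [|x].
    by rewrite !inE syY sy (le_comparable sy_y).
  (* A point of the link below [y] is fixed, hence below [s y] by monotonicity; one above [y] is
     above [s y]. *)
  rewrite !inE => /and3P[xY xy]; rewrite /Order.comparable le_eqVlt (negPf xy) /=.
  case/orP=> [xlty|yx]; last by rewrite (le_trans sy_y yx) orbT.
  by rewrite -(lty x) // smono // ltW.
apply: IHn => [|x|x z|].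
- by move: leYn; rewrite (cardsD1 y) yY.
- rewrite !inE => /andP[xy xY]; have [sxY ssx sxx] := sY x xY.
  by split=> //; rewrite sxY andbT; apply: contraNneq sy => <-; rewrite ssx.
- by rewrite !inE => /andP[_ xY] /andP[_ zY]; exact: smono.
suff -> : [set x in Y :\ y | s x == x] = [set x in Y | s x == x] by [].
apply/setP=> x; rewrite !inE; case: eqVneq => // ->.
by rewrite (negPf sy) !andbF.
Qed.

(** * Smith theory *)

Definition pull s : C -> C := wpull (fun=> 1) (fun c => s @: c).
HB.instance Definition _ s := GRing.Linear.on (pull s).

Lemma pullE s f c : pull s f c = f (s @: c).
Proof. by rewrite ffunE mul1r. Qed.

Lemma bd_pull s f : {mono s : x y / (x <= y)%O} -> bd (pull s f) = pull s (bd f).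
Proof.
move=> smono; have s_inj := inc_inj smono; have slt := leW_mono smono.
apply/ffunP => c; rewrite pullE !ffunE [RHS](reindex_inj s_inj) /=.
apply: eq_big => [x|x xc]; first by rewrite mem_imset.
rewrite pullE imsetU1; congr (_ ^+ _ * _); rewrite -(card_imset _ s_inj).
congr #|pred_of_set _|; apply/setP=> y; rewrite inE.
apply/imsetP/andP => [[z /[!inE]/andP[zc zx] ->]|[/imsetP[z zc ->] zx]].
  by rewrite imset_f // slt.
by exists z; rewrite // inE zc -slt.
Qed.

Lemma mono_iter s i : {mono s : x y / (x <= y)%O} ->
  {mono iter i s : x y / (x <= y)%O}.
Proof. by move=> smono x y; elim: i => //= i; rewrite smono. Qed.

Lemma imset_iter s i c : iter i (fun c => s @: c) c = iter i s @: c.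
Proof.
elim: i => [|i /= ->]; first by rewrite /= imset_id.
by rewrite -imset_comp.
Qed.

(** A strict inequality between [x] and [s x] would propagate around the finite orbit to [x < x].
    Hence a stable chain is fixed pointwise. *)
Lemma mono_fixed s x : {mono s : x y / (x <= y)%O} -> (s x >=< x)%O -> s x = x.
Proof.
move=> smono; have s_inj := inc_inj smono; have slt := leW_mono smono.
have it_lt n : ((x < s x)%O -> (x < iter n.+1 s x)%O)
    /\ ((s x < x)%O -> (iter n.+1 s x < x)%O).
  elim: n => //= n [IH1 IH2]; split=> [xs|sx].
    by rewrite (lt_trans xs) // slt IH1.
  by rewrite (lt_trans _ sx) // slt IH2.
have := it_lt (order s x).-1; rewrite orderSpred iter_order // ltxx => -[H1 H2].
by rewrite /Order.comparable !le_eqVlt => /orP[/orP[/eqP|/H2]|/orP[/eqP|/H1]].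
Qed.

Lemma chain_fixed s c x : {mono s : x y / (x <= y)%O} -> is_chain c ->
  s @: c = c -> x \in c -> s x = x.
Proof.
move=> smono /chainP chc sc xc; apply: mono_fixed => //.
by apply: chc => //; rewrite -sc imset_f.
Qed.

Lemma chains_imset Y s c : {mono s : x y / (x <= y)%O} ->
  (forall x, (s x \in Y) = (x \in Y)) -> (s @: c \in chains Y) = (c \in chains Y).
Proof.
move=> smono sY; apply/chainsP/chainsP => -[/chainP chc /subsetP cY]; split.
- apply/chainP => x y xc yc; have := chc _ _ (imset_f s xc) (imset_f s yc).
  by rewrite /Order.comparable !smono.
- by apply/subsetP => x xc; rewrite -sY cY ?imset_f.
- apply/chainP => _ _ /imsetP[x xc ->] /imsetP[y yc ->].
  by rewrite /Order.comparable !smono; exact: chc.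
- by apply/subsetP => _ /imsetP[x xc ->]; rewrite sY cY.
Qed.

Definition fix_in s Y : {set X} := [set x in Y | s x == x].

Lemma chains_fix Y s c : {mono s : x y / (x <= y)%O} ->
  (c \in chains (fix_in s Y)) = (c \in chains Y) && (s @: c == c).
Proof.
move=> smono; apply/chainsP/andP => [[chc /subsetP cY]|[/chainsP[chc /subsetP cY] /eqP sc]].
  split; first by apply/chainsP; split=> //; apply/subsetP=> x /cY /[!inE]/andP[].
  have cs : {in c, s =1 id} by move=> x /cY /[!inE]/andP[_ /eqP].
  by apply/eqP; rewrite (eq_in_imset cs) imset_id.
split=> //; apply/subsetP => x xc; rewrite inE cY //=.
by apply/eqP; exact: chain_fixed sc xc.
Qed.

Definition restrict (K : {set {set X}}) (f : C) : C :=
  [ffun c => if c \in K then f c else 0].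

Lemma supp_restrict K K' f : supp_in K f -> supp_in (K :&: K') (restrict K' f).
Proof.
move=> Kf c; rewrite inE negb_and ffunE => /orP[/Kf ->|/negPf-> //].
by rewrite if_same.
Qed.

Section Smith.

Variables (p : nat) (s : X -> X) (Y : {set X}).
Hypotheses (pF : p \in [pchar F]) (smono : {mono s : x y / (x <= y)%O}).
Hypotheses (sp : forall x, iter p s x = x) (sY : forall x, (s x \in Y) = (x \in Y)).

Let p_pr : prime p := pcharf_prime pF.

(* The norm and the difference operator of s, which annihilate each other: these
   are the two operators that alternate in the Smith sequences. *)
Definition rho (b : bool) (f : C) : C :=
  if b then \sum_(i < p) pull (iter i s) f else f - pull s f.

Fact rho_linear b : linear (rho b).
Proof.
move=> k f g; case: b => /=; last first.
  by rewrite linearP scalerBr opprD addrACA.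
rewrite scaler_sumr -big_split /=; apply: eq_bigr => i _; exact: linearP.
Qed.
HB.instance Definition _ b := GRing.isLinear.Build F C C *:%R (rho b) (rho_linear b).

Lemma rhoTE f c : rho true f c = \sum_(i < p) f (iter i (fun c => s @: c) c).
Proof. by rewrite /rho sum_ffunE; apply: eq_bigr => i _; rewrite pullE imset_iter. Qed.

Lemma rhoFE f c : rho false f c = f c - f (s @: c).
Proof. by rewrite !ffunE mul1r. Qed.

Lemma bd_rho b f : bd (rho b f) = rho b (bd f).
Proof.
case: b; rewrite /rho; last by rewrite linearB -bd_pull.
rewrite raddf_sum; apply: eq_bigr => i _; rewrite -bd_pull //; exact: mono_iter.
Qed.

Lemma imset_sp c : iter p (fun c => s @: c) c = c.
Proof. by rewrite imset_iter (eq_imset _ sp) imset_id. Qed.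

Lemma rho_rho b f : rho b (rho (~~ b) f) = 0.
Proof.
have tel c : \sum_(i < p) (f (iter i (fun c => s @: c) c)
    - f (iter i.+1 (fun c => s @: c) c)) = 0.
  rewrite -(big_mkord xpredT (fun i => f (iter i _ c) - f (iter i.+1 _ c))).
  rewrite -[LHS]opprK -sumrN; under eq_bigr do rewrite opprB.
  by rewrite telescope_sumr // imset_sp subrr oppr0.
apply/ffunP => c; rewrite [RHS]ffunE; case: b => /=.
  rewrite rhoTE -[RHS](tel c); apply: eq_bigr => i _; exact: rhoFE.
rewrite rhoFE !rhoTE -sumrB -[RHS](tel c).
by apply: eq_bigr => i _; rewrite -iterSr.
Qed.

(** Characteristic p enters here: on a fixed set the norm is multiplication by p. *)
Lemma rho_fixed b f c : s @: c = c -> rho b f c = 0.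
Proof.
move=> sc; case: b; last by rewrite rhoFE sc subrr.
rewrite rhoTE (eq_bigr (fun=> f c)) => [|i _].
  by rewrite sumr_const card_ord -[f c]mul1r -mulrnAl (pcharf0 pF) mul0r.
by congr (f _); elim: (nat_of_ord i) => //= n ->.
Qed.

Let fixed := [set c : {set X} | s @: c == c].

(** Exactness of the Smith sequences: on free orbits the kernel of each operator is the image of the
    other, by the two orbit lemmas, and on fixed sets both operators vanish. *)
Lemma rho_ker b K f : (forall c, (s @: c \in K) = (c \in K)) ->
    supp_in K f -> rho b f = 0 ->
  exists2 g, supp_in K g & f = restrict fixed f + rho (~~ b) g.
Proof.
move=> sK Kf f0.
suff [g fg] : exists g : {set X} -> F, forall c, s @: c != c -> f c =
    rho (~~ b) [ffun c => g c] c.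
  exists (restrict K [ffun c => g c]).
    by move=> c /negPf cK; rewrite ffunE cK.
  have itK i c : (iter i (fun c => s @: c) c \in K) = (c \in K).
    by elim: i => //= i <-.
  apply/ffunP => c; rewrite [RHS]ffunE [restrict _ _ _]ffunE inE.
  have [sc|sc] := eqVneq (s @: c) c; first by rewrite rho_fixed // addr0.
  rewrite add0r; have [cK|cK] := boolP (c \in K).
    rewrite fg //; case: b {f0 fg} => /=.
      by rewrite !rhoFE !ffunE sK cK.
    by rewrite !rhoTE; apply: eq_bigr => i _; rewrite !ffunE itK cK.
  rewrite Kf //; case: b {f0 fg} => /=.
    by rewrite rhoFE !ffunE sK (negPf cK) subrr.
  by rewrite rhoTE big1 // => i _; rewrite !ffunE itK (negPf cK).
have f0c c : rho b f c = 0 by rewrite f0 ffunE.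
case: b {f0} f0c => /= f0.
  have [|g fg] := sum_orbit0_boundary p_pr imset_sp (f := f).
    by move=> c; rewrite -rhoTE.
  by exists g => c /fg ->; rewrite rhoFE !ffunE.
have [|g fg] := invariant_sum_orbit p_pr imset_sp (f := f).
  by move=> c; have /eqP := f0 c; rewrite rhoFE subr_eq0 => /eqP.
by exists g => c /fg ->; rewrite rhoTE; apply: eq_bigr => i _; rewrite ffunE.
Qed.

Lemma supp_rho b K f : (forall c, (s @: c \in K) = (c \in K)) ->
  supp_in K f -> supp_in K (rho b f).
Proof.
move=> sK Kf c cK; case: b; last by rewrite rhoFE !Kf ?subrr ?sK.
rewrite rhoTE big1 // => i _; apply: Kf.
suff -> : (iter i (fun c => s @: c) c \in K) = (c \in K) by [].
by elim: (nat_of_ord i) => //= n <-.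
Qed.

Lemma rho_supp_fixed b f : supp_in fixed f -> rho b f = 0.
Proof.
move=> ff; apply/ffunP => c; rewrite [RHS]ffunE.
have [|cf] := boolP (c \in fixed); first by rewrite inE => /eqP; exact: rho_fixed.
have stf c' : (s @: c' \in fixed) = (c' \in fixed).
  by rewrite !inE (inj_eq (imset_inj (inc_inj smono))).
exact: (supp_rho b stf ff cf).
Qed.

Let large k := [set c : {set X} | (k <= #|c|)%N].

(** The boundary lowers cardinality by exactly one, so the small sets of a filling contribute only
    where [bd f] vanishes anyway. *)
Lemma bd_restrict k f : supp_in (large k) (bd f) ->
  bd (restrict (large k.+1) f) = bd f.
Proof.
move=> lf; apply/ffunP => c; have [|kc] := boolP (c \in large k).
  rewrite inE => kc; rewrite !ffunE; apply: eq_bigr => x xc.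
  by rewrite ffunE inE cardsU1 xc ltnS kc.
rewrite [RHS]lf // ffunE big1 // => x xc.
move: kc; rewrite !inE ffunE inE cardsU1 xc ltnS => /negPf->.
by rewrite mulr0.
Qed.

(* Since Y is acyclic, a cycle f + rho b g bounds some w, and rho (~~ b) w is
   again a cycle, supported on larger chains, hence a boundary by induction; so
   up to a boundary w lies in the kernel of rho (~~ b), given by rho_ker. *)
Lemma smith_step k b f g : acyclic Y ->
    supp_in (chains (fix_in s Y) :&: large k) f ->
    supp_in (chains Y :&: large k) g -> bd (f + rho b g) = 0 ->
  exists f' g', [/\ supp_in (chains (fix_in s Y)) f',
    supp_in (chains Y) g', f = bd f' & rho b g = bd (rho b g')].
Proof.
move=> acY; have [m] := ubnP (#|X|.+1 - k); elim: m => // m IHm in k b f g *.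
move=> leXm Yf Yg z0.
have YsY : chains (fix_in s Y) \subset chains Y.
  by apply/subsetP => c; rewrite chains_fix // => /andP[].
have [ltXk|leXk] := ltnP #|X| k.
  have big c K : c \notin K :&: large k.
    by rewrite !inE [(k <= _)%N]leqNgt (leq_ltn_trans (max_card _) ltXk) andbF.
  have h0 (h : C) K : supp_in (K :&: large k) h -> h = 0.
    by move=> Kh; apply/ffunP => c; rewrite Kh ?ffunE.
  exists 0, 0; rewrite (h0 _ _ Yf) (h0 _ _ Yg) !linear0.
  by split=> // c _; rewrite ffunE.
have stY c : (s @: c \in chains Y) = (c \in chains Y) by exact: chains_imset.
have stYk c j : (s @: c \in chains Y :&: large j) = (c \in chains Y :&: large j).
  by rewrite !in_setI stY; congr (_ && _); rewrite !inE card_imset //; exact: inc_inj.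
have Yz : supp_in (chains Y :&: large k) (f + rho b g).
  apply: suppD; first by apply: supp_mono Yf; rewrite setSI.
  exact: supp_rho.
have [|//|w0 Yw0 zw0] := acY (f + rho b g).
  by apply: supp_mono Yz; rewrite subsetIl.
pose w := restrict (large k.+1) w0.
have Yw : supp_in (chains Y :&: large k.+1) w by exact: supp_restrict.
have zw : f + rho b g = bd w.
  by rewrite bd_restrict // -zw0; apply: supp_mono Yz; rewrite subsetIr.
have rf0 : rho (~~ b) f = 0.
  apply: rho_supp_fixed; apply: supp_mono Yf; apply/subsetP => c.
  by rewrite in_setI chains_fix // => /andP[/andP[_ sc] _]; rewrite inE.
have [||||_ [g1 [_ Yg1 _ wg1]]] := IHm k.+1 (~~ b) 0 w => //.
- by rewrite subSS; move: leXm; rewrite subSn.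
- by move=> c _; rewrite ffunE.
- rewrite add0r bd_rho -zw linearD /= rf0 add0r.
  by rewrite -[X in rho _ (rho X _)]negbK rho_rho.
pose u := w - bd g1.
have Yu : supp_in (chains Y) u.
  by apply: suppB (supp_bd Yg1); apply: supp_mono Yw; rewrite subsetIl.
have [|||g2 Yg2 ug2] := @rho_ker (~~ b) (chains Y) u => //.
  by rewrite linearB /= -bd_rho wg1 subrr.
rewrite negbK in ug2.
have Yf' : supp_in (chains (fix_in s Y)) (restrict fixed u).
  apply: supp_mono (supp_restrict Yu); apply/subsetP => c.
  by rewrite in_setI chains_fix // [c \in fixed]inE.
have zE : f + rho b g = bd (restrict fixed u) + bd (rho b g2).
  by rewrite -linearD -ug2 linearB /= (bd_bd Yg1) subr0.
(* Values of [rho] vanish on fixed chains, while [f] and the new boundary vanish off them, so the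
   equation splits into two. *)
have fE : f = bd (restrict fixed u).
  apply/ffunP => c; have [sc|sc] := eqVneq (s @: c) c.
    have := congr1 (fun h : C => h c) zE.
    by rewrite bd_rho [LHS]ffunE [RHS]ffunE !rho_fixed ?addr0.
  have cY : c \notin chains (fix_in s Y) by rewrite chains_fix // negb_and sc orbT.
  by rewrite (supp_bd Yf') // Yf // in_setI (negPf cY).
exists (restrict fixed u), g2; split=> //.
by apply: (addrI f); rewrite zE -fE.
Qed.

Theorem smith : acyclic Y -> acyclic (fix_in s Y).
Proof.
move=> acY f Yf df0.
(* Level 0 puts no condition on sizes, and [g = 0] leaves just the given cycle of the fixed
   poset. *)
have [|||f' [_ [Yf' _ ff' _]]] := @smith_step 0 true f 0 acY.
- by move=> c; rewrite in_setI [c \in large _]inE andbT; exact: Yf.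
- by move=> c _; rewrite ffunE.
- by rewrite linear0 addr0.
by exists f'.
Qed.

End Smith.

(** * The Lefschetz fixed point theorem *)

Fact restrict_linear K : linear (restrict K).
Proof.
move=> k f g; apply/ffunP => c; rewrite !ffunE.
by case: ifP => // _; rewrite scaler0 addr0.
Qed.
HB.instance Definition _ K := GRing.isLinear.Build F C C *:%R (restrict K) (restrict_linear K).

Lemma restrict_id K f : supp_in K f -> restrict K f = f.
Proof. by move=> Kf; apply/ffunP => c; rewrite ffunE; case: ifPn => // /Kf. Qed.

Lemma restrict_supp K f : supp_in K (restrict K f).
Proof. by move=> c /negPf cK; rewrite ffunE cK. Qed.

(** Over a field the boundary has a linear section on its image; [h] projects to the cycles and then
    applies this section. *)
Lemma acyclic_homotopy Y : acyclic Y ->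
  exists h : {linear C -> C}, (forall f, supp_in (chains Y) (h f)) /\
    (forall f, supp_in (chains Y) f -> f = bd (h f) + h (bd f)).
Proof.
move=> acY; pose K := chains Y.
pose D : 'End(C) := linfun (bd \o restrict K).
have DE f : D f = bd (restrict K f) by rewrite lfunE.
(* Subtracting the chosen preimage of the boundary projects the chains of [Y] onto the cycles. *)
pose k : {linear C -> C} := restrict K \o (idfun \- (inv_lfun D \o D)).
have kE f : k f = restrict K (f - inv_lfun D (D f)) by [].
exists (restrict K \o inv_lfun D \o k); split=> [f|f Kf]; first exact: restrict_supp.
have DK g : g \in limg D -> D (inv_lfun D g) = g by exact: limg_lfunVK.
have imD g : D g \in limg D by rewrite memv_img ?memvf.
have [||g Kg kg] := acY (k f).
- by rewrite kE; exact: restrict_supp.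
- by rewrite kE -DE linearB /= DK // subrr.
have Kdf := supp_bd Kf.
have kdf : k (bd f) = bd f.
  rewrite kE DE (restrict_id Kdf) (bd_bd Kf) linear0 subr0.
  exact: restrict_id.
rewrite -[LHS]/f -[RHS]/(bd (restrict K (inv_lfun D (k f)))
  + restrict K (inv_lfun D (k (bd f)))) kdf -DE DK; last by rewrite kg -(restrict_id Kg) -DE.
have <- : D f = bd f by rewrite DE restrict_id.
by rewrite kE -linearD /= subrK restrict_id.
Qed.

Definition delta c : C := [ffun c' => (c' == c)%:R].

Definition trace K (A : C -> C) : F := \sum_(c in K) A (delta c) c.

Lemma linear_delta K (A : {linear C -> C}) f e : supp_in K f ->
  A f e = \sum_(c in K) f c * A (delta c) e.
Proof.
move=> Kf; have {1}-> : f = \sum_(c in K) f c *: delta c.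
  apply/ffunP => c; rewrite sum_ffunE; have [cK|cK] := boolP (c \in K).
    rewrite (bigD1 c) //= big1 => [|c' /andP[_ cc']].
      by rewrite !ffunE eqxx addr0 /GRing.scale /= mulr1.
    by rewrite !ffunE eq_sym (negPf cc') scaler0.
  rewrite Kf // big1 // => c' cK'; rewrite !ffunE.
  by case: eqP => [cc'|]; rewrite ?scaler0 //; rewrite cc' cK' in cK.
rewrite linear_sum sum_ffunE; apply: eq_bigr => c _.
by rewrite linearZ ffunE.
Qed.

Lemma supp_delta K c : c \in K -> supp_in K (delta c).
Proof.
by move=> cK c'; rewrite ffunE; case: eqP => // ->; rewrite cK.
Qed.

Lemma trace_comm K (A B : {linear C -> C}) :
  (forall f, supp_in K f -> supp_in K (A f)) ->
  (forall f, supp_in K f -> supp_in K (B f)) ->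
  trace K (A \o B) = trace K (B \o A).
Proof.
move=> KA KB; rewrite /trace /=.
under eq_bigr => c cK do rewrite (linear_delta _ _ (KB _ (supp_delta cK))).
under [RHS]eq_bigr => c cK do rewrite (linear_delta _ _ (KA _ (supp_delta cK))).
rewrite exchange_big /=; apply: eq_bigr => c _; apply: eq_bigr => e _.
exact: mulrC.
Qed.

(* The supertrace of s on the chains of Y vanishes because s commutes with a
   contraction; without fixed points only the empty chain would contribute. *)
Theorem lefschetz Y s : {mono s : x y / (x <= y)%O} ->
    (forall x, (s x \in Y) = (x \in Y)) -> acyclic Y ->
  exists2 x, x \in Y & s x = x.
Proof.
move=> smono sY acY; have [h [Kh hE]] := acyclic_homotopy acY.
have [[x xY /eqP]|noF] := altP (@exists_inP _ (mem Y) (fun x => s x == x)).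
  by exists x.
pose K := chains Y.
(* The sign turns the ordinary trace of [G] into the supertrace of [s] and makes [G] anticommute
   with [bd]. *)
pose G : {linear C -> C} := wpull (fun c => (-1) ^+ #|c|) (fun c => s @: c).
have GE f c : G f c = (-1) ^+ #|c| * pull s f c by rewrite pullE ffunE.
have bdG f : bd (G f) = - G (bd f).
  apply/ffunP => c; rewrite [RHS]ffunE GE -bd_pull // !ffunE -mulNr mulr_sumr.
  by apply: eq_bigr => x xc; rewrite GE cardsU1 xc exprS mulN1r mulrCA.
have KG f : supp_in K f -> supp_in K (G f).
  by move=> Kf c cK; rewrite GE pullE Kf ?mulr0 // chains_imset.
have trG : trace K G = 1.
  rewrite /trace (bigD1 set0) /=; last first.
    apply/chainsP; rewrite sub0set; split=> //; apply/chainP=> x y.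
    by rewrite inE.
  rewrite GE pullE ffunE imset0 cards0 eqxx mul1r big1 ?addr0 //.
  move=> c /andP[/chainsP[chc /subsetP cY] /set0Pn[x xc]].
  rewrite GE pullE ffunE; case: eqP => [sc|]; last by rewrite mulr0.
  case/negP: noF; apply/exists_inP; exists x; first exact: cY.
  by apply/eqP; exact: chain_fixed sc xc.
(* Insert the identity [bd h + h bd]; cyclicity of the trace moves [bd] to the front of the second
   term, where anticommutation cancels it against the first. *)
have : trace K G = trace K ((G \o bd) \o h) + trace K ((G \o h) \o bd).
  rewrite /trace -big_split; apply: eq_bigr => c cK.
  by rewrite /= {1}[delta c](hE _ (supp_delta cK)) linearD ffunE.
rewrite (trace_comm (A := G \o h)); first last.
- by move=> f; exact: supp_bd.
- by move=> f _; apply: KG; exact: Kh.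
rewrite trG -big_split big1 => [/eqP|c _]; first by rewrite oner_eq0.
by rewrite /= bdG [X in _ + X]ffunE subrr.
Qed.

End OrderComplex.

(** * Nonevasive properties are acyclic *)

Import Order.DefaultSetSubsetOrder.

Lemma decidable_within_card n (P : {set graph n}) : decidable_within P #|edge n|.
Proof.
suff H s (Q : {set graph n}) : exists T : strategy n, forall G,
    answer T G = (G :&: [set:: s] \in Q) /\ questions T G = size s.
  have [T TP] := H (enum (edge n)) P; exists T => G; have [-> ->] := TP G.
  rewrite -cardE leqnn; split=> //; congr (_ \in P).
  by apply/setP=> e; rewrite !inE mem_enum andbT.
elim: s Q => [|e s IHs] Q.
  by exists (Answer n (set0 \in Q)) => G; rewrite set_nil setI0.
(* After a yes, [e] is known to be present, so the rest of the strategy decides whether adding [e]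
   to what it sees gives a member of [Q]. *)
have [Ty TyP] := IHs [set G | e |: G \in Q]; have [Tn TnP] := IHs Q.
exists (Ask e Ty Tn) => G /=; case: ifPn => eG.
  have [-> ->] := TyP G; split=> //; rewrite inE; congr (_ \in Q).
  apply/setP=> x; rewrite !inE.
  by case: eqP => [->|]; rewrite ?eG.
have [-> ->] := TnP G; split=> //; congr (_ \in Q).
apply/setP=> x; rewrite !inE.
by case: eqP => [->|]; rewrite ?(negPf eG).
Qed.

Lemma card_edge n : #|edge n| = 'C(n, 2).
Proof.
by have := card_draws 'I_n 2; rewrite card_ord cardsE => <-; exact: card_sig.
Qed.

Lemma nonevasive_decidable n (P : {set graph n}) : ~ evasive P ->
  exists2 k, k < #|edge n| & decidable_within P k.
Proof.
rewrite /evasive /complexity; case: ex_minnP => k /asboolP Pk kmin nev.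
exists k => //; have := kmin _ (asboolT (decidable_within_card P)).
by rewrite leq_eqVlt card_edge => /orP[/eqP //|].
Qed.

Lemma le_setE (T : finType) (A B : {set T}) : (A <= B)%O = (A \subset B).
Proof. by []. Qed.

Lemma disjoint_setU1l (T : finType) (x : T) (A B : {set T}) :
  [disjoint x |: A & B] = (x \notin B) && [disjoint A & B].
Proof. by rewrite -setI_eq0 setIUl setU_eq0 !setI_eq0 disjoints1. Qed.

Lemma disjoint_setU1r (T : finType) (x : T) (A B : {set T}) :
  [disjoint A & x |: B] = (x \notin A) && [disjoint A & B].
Proof. by rewrite disjoint_sym disjoint_setU1l disjoint_sym. Qed.

Lemma setD1_notin (T : finType) (x : T) (A : {set T}) : x \notin A -> A :\ x = A.
Proof. by move=> xA; apply/eqP; rewrite eqEsubset subD1set subsetD1 subxx xA. Qed.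

Section Nonevasive.

Variables (F : fieldType) (n : nat) (P : {set graph n}).
Hypothesis monoP : monotone_property P.

Implicit Types G S N : graph n.

Local Notation X := {set edge n}.

(* S and N are the edges that already got the answers yes and no. *)
Definition between S N : {set X} :=
  [set G : X | [&& S \proper G, [disjoint G & N] & G \in P]].

Lemma betweenP S N G :
  reflect [/\ S \proper G, [disjoint G & N] & G \in P]
    (G \in between S N).
Proof. by rewrite inE; exact: and3P. Qed.

(* When e is asked, removing e retracts the graphs other than e |: S onto those
   avoiding e, and the link of e |: S is between (e |: S) N. *)
Lemma acyclic_between T k S N :
    (forall G, S \subset G -> [disjoint G & N] ->
      answer T G = (G \in P) /\ questions T G <= k) ->
    [disjoint S & N] -> k < #|~: (S :|: N)| -> S \in P ->
  acyclic F (between S N).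
Proof.
elim: T k S N => [b|e Ty IHy Tn IHn] k S N TP SN kSN SP.
  (* At a leaf the answer for [S] holds for the whole interval, whose largest element [~: N] is an
     apex; the undetermined edges make it differ from [S]. *)
  have PG G : S \subset G -> [disjoint G & N] -> G \in P.
    move=> SG GN; have /= [<- _] := TP G SG GN.
    by have /= [-> _] := TP S (subxx S) SN.
  apply: (@acyclic_cone _ _ _ _ (~: N : X)).
    have SN' : S \subset ~: N by rewrite -disjoints_subset.
    have NN : [disjoint ~: N & N] by rewrite disjoints_subset.
    apply/betweenP; split; [|by []|exact: PG].
    rewrite properEneq SN' andbT; apply: contraTneq kSN => SE.
    by rewrite -leqNgt SE setUC setUCr setCT cards0.
  move=> G /betweenP[_ GN _]; apply: le_comparable.
  by rewrite le_setE -disjoints_subset.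
(* A repeated question has a known answer: follow that branch with the same bound [k]. *)
have [eS|eS] := boolP (e \in S).
  apply: (IHy k) => // G SG GN; have := TP G SG GN.
  by rewrite /= (subsetP SG) // => -[-> /ltnW].
have [eN|eN] := boolP (e \in N).
  apply: (IHn k) => // G SG GN; have := TP G SG GN.
  by rewrite /= (disjointFl GN) // => -[-> /ltnW].
have k_gt0 : 0 < k by have /= [_] := TP S (subxx S) SN; case: (k).
have SeN : [disjoint S & e |: N] by rewrite disjoint_setU1r eS.
have SeN' : [disjoint e |: S & N] by rewrite disjoint_setU1l eN.
have SNe : #|~: (S :|: (e |: N))| = #|~: (S :|: N)|.-1.
  rewrite (cardsD1 e (~: (S :|: N))) !inE negb_or eS eN /=.
  by congr #|pred_of_set _|; rewrite setUCA setCU setDE setIC.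
have kSN' : k.-1 < #|~: (S :|: N)|.-1.
  by rewrite -ltnS prednK // prednK // (leq_ltn_trans _ kSN).
have acN : acyclic F (between S (e |: N)).
  apply: (IHn k.-1); rewrite ?SNe // => G SG.
  rewrite disjoint_setU1r => /andP[eG GN]; have := TP G SG GN.
  by rewrite /= (negPf eG) -{1}(prednK k_gt0) => -[->].
have neE G : e \notin G -> G \in between S N -> G \in between S (e |: N).
  move=> eG /betweenP[SG GN PG]; apply/betweenP; split=> //.
  by rewrite disjoint_setU1r eG.
(* If [e |: S] is outside [P], monotonicity excludes [e] from every graph of the interval. *)
have [eSP|eSP] := boolP (e |: S \in P); last first.
  suff -> : between S N = between S (e |: N) by [].
  apply/setP => G; apply/idP/idP => [GY|/betweenP[SG GN PG]].
    apply: (neE _ _ GY); apply: contra eSP => eG.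
    have /betweenP[SG _] := GY; apply: monoP.
    by rewrite subUset sub1set eG proper_sub.
  by apply/betweenP; split=> //; move: GN; rewrite disjoint_setU1r => /andP[].
have acS : acyclic F (between (e |: S) N).
  apply: (IHy k.-1) => //.
    move=> G; rewrite subUset sub1set => /andP[eG SG] GN; have := TP G SG GN.
    by rewrite /= eG -{1}(prednK k_gt0) => -[->].
  suff -> : e |: S :|: N = S :|: (e |: N) by rewrite SNe.
  by rewrite setUAC setUC setUA.
pose y : graph n := e |: S.
have yY : y \in between S N.
  apply/betweenP; split=> //; rewrite properE subsetUr; apply/subsetPn.
  by exists e => //; rewrite setU11.
apply: (acyclic_link yY).
  suff -> : link (between S N) y = between y N by [].
  apply/setP => G; rewrite inE; apply/and3P/betweenP => [[]|[yG GN PG]].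
    move=> /betweenP[SG GN PG] Gy Gyc; split=> //.
    move: Gyc; rewrite /Order.comparable !le_setE => /orP[Gsy|ySG]; last first.
      by rewrite properEneq eq_sym Gy.
    (* No graph lies strictly between [S] and [e |: S], so the link only extends upwards. *)
    case/negP: Gy; rewrite eqEsubset Gsy /y subUset sub1set proper_sub // andbT /=.
    apply: contraT => eG; have [_ /subsetPn[z zG zS]] := andP SG.
    have := subsetP Gsy _ zG; rewrite !inE (negPf zS) orbF => /eqP ze.
    by rewrite ze (negPf eG) in zG.
  have Sy : S \subset y := subsetUr _ _.
  split.
  - by apply/betweenP; split=> //; exact: sub_proper_trans yG.
  - by case/properP: yG => _ [z zG]; apply: contraNneq => <-.
  - by rewrite /Order.comparable !le_setE (proper_sub yG) orbT.
(* With [y] gone the retraction is well defined: [y] was the only graph of the interval sent to [S],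
   which is not in the interval. *)
apply: (@acyclic_closure _ _ _ _ (fun G : graph n => G :\ e)).
- move=> G; rewrite in_setD1 => /andP[Gy /betweenP[SG GN PG]].
  have SGe : S \subset G :\ e by rewrite subsetD1 proper_sub.
  split; [|by rewrite setDDl setUid|by rewrite le_setE subD1set].
  rewrite in_setD1; apply/andP; split.
    by apply/eqP => GeE; have := setU11 e S; rewrite -/y -GeE setD11.
  apply/betweenP; split; last 1 first.
  + exact: monoP (subD1set _ _) PG.
  + rewrite properEneq SGe andbT; apply: contra Gy => /eqP SE.
    have [eG|eG] := boolP (e \in G); first by rewrite /y SE setD1K.
    by move: SG; rewrite SE setD1_notin // properxx.
  + exact: disjointWl (subD1set _ _) GN.
- by move=> G H _ _; rewrite !le_setE; exact: setSD.
suff -> : [set G in between S N :\ y | G :\ e == G] = between S (e |: N) by [].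
apply/setP => G; rewrite inE in_setD1; apply/idP/idP => [/andP[/andP[_ GY] /eqP GE]|].
  by apply: (neE _ _ GY); rewrite -GE setD11.
case/betweenP=> SG; rewrite disjoint_setU1r => /andP[eG GN] PG.
rewrite (setD1_notin eG) eqxx andbT; apply/andP; split; last exact/betweenP.
by apply: contraNneq eG => ->; exact: setU11.
Qed.

Theorem nonevasive_acyclic : ~ evasive P -> P <> set0 ->
  acyclic F [set G : X | (G != set0) && (G \in P)].
Proof.
move=> /nonevasive_decidable[k kE [T TP]] /eqP/set0Pn[G0 G0P].
have P0 : set0 \in P by exact: monoP (sub0set _) G0P.
suff -> : [set G : X | (G != set0) && (G \in P)] = between set0 set0.
  apply: (@acyclic_between T k); rewrite ?setU0 ?setC0 ?cardsT //.
  by rewrite -setI_eq0 setI0 eqxx.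
apply/setP => G; rewrite !inE proper0; congr (_ && _).
by rewrite -setI_eq0 setI0 eqxx.
Qed.

End Nonevasive.

(** * The affine group acting on graphs *)

Section VertexPermutations.

Variable n : nat.
Implicit Types (G : graph n) (s u : 'S_n).

Definition act s G : {set edge n} := map_graph (@perm_inj _ s) G.

Lemma map_edge_inj m k (f : 'I_m -> 'I_k) (fI : injective f) : injective (map_edge fI).
Proof. by move=> e1 e2 /(congr1 val) /= /(imset_inj fI) /val_inj.
Qed.

Lemma mem_map_graph m k (f : 'I_m -> 'I_k) (fI : injective f) (G : graph m) e :
  (map_edge fI e \in map_graph fI G) = (e \in G).
Proof. by rewrite /map_graph mem_imset //; exact: map_edge_inj. Qed.

Lemma act_mono s : {mono act s : G H / (G <= H)%O}.
Proof.
move=> G H; rewrite !le_setE; apply/idP/idP => [sGH|]; last exact: imsetS.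
apply/subsetP => e eG; have := subsetP sGH (map_edge (@perm_inj _ s) e).
by rewrite !mem_map_graph; apply.
Qed.

Lemma actM s u G : act (s * u)%g G = act u (act s G).
Proof.
rewrite /act /map_graph -imset_comp; apply: eq_imset => e.
by apply: val_inj; rewrite /= -imset_comp; apply: eq_imset => i; rewrite /= permM.
Qed.

Lemma act1 G : act 1%g G = G.
Proof.
rewrite /act /map_graph -[RHS]imset_id; apply: eq_imset => e.
apply: val_inj => /=; rewrite -[RHS]imset_id; apply: eq_imset => i.
by rewrite perm1.
Qed.

Lemma iter_act s k G : iter k (act s) G = act (s ^+ k)%g G.
Proof. by elim: k => [|k IHk]; rewrite ?act1 //= IHk expgSr actM. Qed.

Lemma act_property (P : {set graph n}) s G : graph_property P ->
  (act s G \in P) = (G \in P).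
Proof.
move=> isoP; apply/idP/idP; last by apply: isoP; exists s.
by apply: isoP; exists s^-1%g; rewrite -/(act _ _) -actM mulgV act1.
Qed.

Lemma act_eq0 s G : (act s G == set0) = (G == set0).
Proof. exact: imset_eq0. Qed.

Definition adj G i j := [exists e in G, val e == [set i; j]].

Lemma adjE G e i j : val e = [set i; j] -> adj G i j = (e \in G).
Proof.
move=> eE; apply/exists_inP/idP => [[f fG /eqP fE]|eG]; last by exists e; rewrite ?eE.
by have -> : e = f by apply: val_inj; rewrite eE fE.
Qed.

Lemma adjC G i j : adj G i j = adj G j i.
Proof. by rewrite /adj setUC. Qed.

Lemma adj_act s G i j : act s G = G -> adj G i j -> adj G (s i) (s j).
Proof.
move=> sG /exists_inP[e eG /eqP eE].
rewrite (@adjE _ (map_edge (@perm_inj _ s) e)); last by rewrite /= eE imsetU1 imset_set1.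
by rewrite -sG mem_map_graph.
Qed.

Lemma adj_iter s k G i j : act s G = G -> adj G i j ->
  adj G (iter k s i) (iter k s j).
Proof. by move=> sG Gij; elim: k => //= k; exact: adj_act. Qed.

End VertexPermutations.

(** * Permutations acting separately on two blocks of vertices *)

Section SumPermutation.

Variables (a b : nat).

Definition sum_fun (f : 'I_a -> 'I_a) (g : 'I_b -> 'I_b) (k : 'I_(a + b)) :=
  match split k with inl i => lshift b (f i) | inr j => rshift a (g j) end.

Lemma sum_fun_inj f g : injective f -> injective g -> injective (sum_fun f g).
Proof.
move=> fI gI; pose h u := match u with inl i => inl (f i) | inr j => inr (g j) end.
have hE k : sum_fun f g k = unsplit (h (split k)) by rewrite /sum_fun; case: split.
move=> k l; rewrite !hE => /(can_inj (@unsplitK _ _)) kl.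
apply: (can_inj (@splitK _ _)); move: kl.
by case: (split k) (split l) => i [] j //= [] => [/fI|/gI] ->.
Qed.

Definition sum_perm f g (fI : injective f) (gI : injective g) : 'S_(a + b) :=
  perm (sum_fun_inj fI gI).

Lemma sum_perm_lshift f g (fI : injective f) (gI : injective g) i :
  sum_perm fI gI (lshift b i) = lshift b (f i).
Proof. by rewrite permE /sum_fun (unsplitK (inl i)). Qed.

Lemma sum_perm_rshift f g (fI : injective f) (gI : injective g) j :
  sum_perm fI gI (rshift a j) = rshift a (g j).
Proof. by rewrite permE /sum_fun (unsplitK (inr j)). Qed.

End SumPermutation.

Lemma iter_ordS t (k l : 'I_t) : exists m, iter m (@ordS t) k = l.
Proof.
(* [t - k] steps wrap [k] round to 0 and [l] more arrive at [l]; this avoids the truncated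
   [l - k]. *)
exists (l + (t - k)).
have itE m : iter m (@ordS t) k = (k + m) %% t :> nat.
  elim: m => [|m IHm] /=; first by rewrite addn0 modn_small.
  by rewrite IHm -addn1 modnDml addn1 addnS.
apply: val_inj => /=; rewrite itE addnCA subnKC ?(ltnW (ltn_ord k)) //.
by rewrite modnDr modn_small.
Qed.

Lemma finField_generator (F : finFieldType) : exists2 w : F, w != 0%R &
  forall x : F, x != 0%R -> exists m, x = (w ^+ m)%R.
Proof.
have /cyclicP[u uE] := field_unit_group_cyclic [set: {unit F}]%G.
exists (val u) => [|x x0]; first by rewrite -unitfE (valP u).
have xU : x \is a GRing.unit by rewrite unitfE.
have : FinRing.unit F xU \in <[u]>%g by rewrite -uE inE.
by case/cycleP=> m xm; exists m; rewrite -FinRing.val_unitX -xm.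
Qed.

Lemma perm_sum_ext (a b : nat) (s u : 'S_(a + b)) :
  (forall i, s (lshift b i) = u (lshift b i)) ->
  (forall j, s (rshift a j) = u (rshift a j)) -> s = u.
Proof. by move=> sL sR; apply/permP => k; case: (split_ordP k) => i ->. Qed.

(** * Translations of F, and scaling of F combined with rotation *)

Section Affine.

Local Open Scope ring_scope.

Variables (p q t : nat) (F : finFieldType).
Hypotheses (pF : p \in [pchar F]) (cardF : #|F| = q).

Let x (i : 'I_q) : F := enum_val (cast_ord (esym cardF) i).
Let y (a : F) : 'I_q := cast_ord cardF (enum_rank a).

Let xK : cancel x y.
Proof. by move=> i; rewrite /y /x enum_valK cast_ordKV. Qed.

Let yK : cancel y x.
Proof. by move=> a; rewrite /y /x cast_ordK enum_rankK. Qed.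

Fact affine_inj (f : F -> F) : injective f -> injective (fun i => y (f (x i))).
Proof. by move=> fI i j /(can_inj yK)/fI/(can_inj xK). Qed.

Definition translation (b : F) : 'S_(q + t) :=
  sum_perm (affine_inj (@addIr _ b)) (@inj_id 'I_t).

Variables (w : F) (w0 : w != 0).

Definition scale_rotate : 'S_(q + t) :=
  sum_perm (affine_inj (mulfI w0)) (@ordS_inj t).

Lemma translationL b i : translation b (lshift t i) = lshift t (y (x i + b)).
Proof. exact: sum_perm_lshift. Qed.

Lemma translationR b j : translation b (rshift q j) = rshift q j.
Proof. exact: sum_perm_rshift. Qed.

Lemma scale_rotateL i : scale_rotate (lshift t i) = lshift t (y (w * x i)).
Proof. exact: sum_perm_lshift. Qed.

Lemma scale_rotateR j : scale_rotate (rshift q j) = rshift q (ordS j).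
Proof. exact: sum_perm_rshift. Qed.

Lemma translationC b c :
  (translation b * translation c = translation c * translation b)%g.
Proof.
apply: perm_sum_ext => i; rewrite !permM; last by rewrite !translationR.
by rewrite !translationL !yK addrAC.
Qed.

Lemma translationX b : (translation b ^+ p = 1)%g.
Proof.
have trX k i : (translation b ^+ k)%g (lshift t i) = lshift t (y (x i + b *+ k)).
  elim: k => [|k IHk]; first by rewrite perm1 addr0 xK.
  by rewrite expgSr permM IHk translationL yK -addrA -mulrSr.
apply: perm_sum_ext => i; rewrite perm1; first by rewrite trX (mulrn_pchar pF) addr0 xK.
by elim: p => [|k IHk]; rewrite ?perm1 // expgSr permM IHk translationR.
Qed.

(** [scale_rotate] normalises the translations, hence preserves the set of graphs that they all
    fix. *)
Lemma scale_translation b :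
  (translation b * scale_rotate = scale_rotate * translation (w * b)%R)%g.
Proof.
apply: perm_sum_ext => i; rewrite !permM.
  by rewrite translationL !scale_rotateL translationL !yK mulrDr.
by rewrite translationR !scale_rotateR translationR.
Qed.

Variable P : {set graph (q + t)}.
Hypotheses (isoP : graph_property P) (monoP : monotone_property P).
Hypotheses (nevP : ~ evasive P) (P0 : P <> set0).

Let Y : {set {set edge (q + t)}} := [set G : {set edge (q + t)} | (G != set0) && (G \in P)].

(** A list index lets Smith theory, which treats one map of order p, be applied to one translation
    after another; since translations commute, each preserves the graphs fixed by the others. *)
Let Yfix (bs : seq F) :=
  [set G in Y | all (fun b => act (translation b) G == G) bs].

Lemma acyclic_Yfix bs : acyclic F (Yfix bs).
Proof.
elim: bs => [|b bs IHbs].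
  suff -> : Yfix [::] = Y by exact: nonevasive_acyclic.
  by apply/setP => G; rewrite inE andbT.
suff -> : Yfix (b :: bs) = fix_in (act (translation b)) (Yfix bs).
  apply: (smith pF (@act_mono _ (translation b))) => [G|G|//].
  - by rewrite iter_act translationX act1.
  rewrite !inE act_eq0 act_property //; congr (_ && _).
  apply: eq_all => c; rewrite -actM translationC actM.
  exact: (inj_eq (inc_inj (act_mono _))).
by apply/setP => G; rewrite !inE /= andbCA andbC.
Qed.

Lemma exists_affine_fixed : exists G : graph (q + t), [/\ G != set0, G \in P,
  (forall b, act (translation b) G = G) & act scale_rotate G = G].
Proof.
have [|G] := lefschetz (@act_mono _ scale_rotate) _ (@acyclic_Yfix (enum F)).
  move=> G; rewrite !inE act_eq0 act_property //; congr (_ && _).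
  have actI s := inj_eq (inc_inj (@act_mono (q + t) s)).
  apply/allP/allP => H b _.
    rewrite -(actI scale_rotate) -actM scale_translation actM.
    by apply: H; rewrite mem_enum.
  (* As [w] is invertible, every translation is the conjugate of one, here the translation by b /
     w. *)
  rewrite -[b](mulVKf w0) -actM -scale_translation actM actI.
  by apply: H; rewrite mem_enum.
rewrite !inE => /andP[/andP[G0 GP] /allP Gb] Gg; exists G; split=> // b.
by apply/eqP/Gb; rewrite mem_enum.
Qed.

Hypothesis w_gen : forall a : F, a != 0 -> exists m, a = w ^+ m.

(** * Orbits of edges *)

Section Orbits.

Variable G : graph (q + t).
Hypotheses (Gb : forall b, act (translation b) G = G) (Gg : act scale_rotate G = G).

Let scaleL m i : iter m scale_rotate (lshift t i) = lshift t (y (w ^+ m * x i)).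
Proof.
elim: m => [|m IHm] /=; first by rewrite mul1r xK.
by rewrite IHm scale_rotateL yK mulrA -exprS.
Qed.

Let scaleR m j : iter m scale_rotate (rshift q j) = rshift q (iter m (@ordS t) j).
Proof. by elim: m => //= m ->; rewrite scale_rotateR. Qed.

(** The maps sending z to w^m z + b are 2-transitive on F: the generator supplies the ratio of the
    differences, and a translation then matches the endpoints. *)
Lemma adj_left i i' j j' : i != i' -> j != j' ->
  adj G (lshift t i) (lshift t i') -> adj G (lshift t j) (lshift t j').
Proof.
move=> ii' jj'.
have xneq k k' : k != k' -> x k' - x k != 0.
  by rewrite subr_eq0 (can_eq xK) eq_sym.
have /w_gen[m mE] : (x j' - x j) / (x i' - x i) != 0.
  by rewrite mulf_neq0 ?invr_eq0 ?xneq.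
have {}mE : w ^+ m * (x i' - x i) = x j' - x j by rewrite -mE divfK // xneq.
move=> /(adj_iter m Gg)/(adj_act (Gb (x j - w ^+ m * x i))).
rewrite !scaleL !translationL !yK.
have -> : w ^+ m * x i + (x j - w ^+ m * x i) = x j by ring.
have -> : w ^+ m * x i' + (x j - w ^+ m * x i) = w ^+ m * (x i' - x i) + x j by ring.
by rewrite mE subrK !xK.
Qed.

(** Choose [m] to rotate [k] to [l]; a translation, which leaves the last t vertices alone, then
    corrects the other endpoint. *)
Lemma adj_cross i k j l :
  adj G (lshift t i) (rshift q k) -> adj G (lshift t j) (rshift q l).
Proof.
have [m ml] := iter_ordS k l.
move=> /(adj_iter m Gg)/(adj_act (Gb (x j - w ^+ m * x i))).
rewrite scaleL scaleR translationL translationR yK ml.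
have -> : w ^+ m * x i + (x j - w ^+ m * x i) = x j by ring.
by rewrite xK.
Qed.

End Orbits.

Lemma edgeP n (e : edge n) : exists i j, i != j /\ val e = [set i; j].
Proof. by have /cards2P[i [j [ij eE]]] := valP e; exists i, j. Qed.

(** One edge of the invariant graph brings its whole orbit, and monotonicity discards the rest; the
    three cases record on which sides the endpoints of that edge lie. *)
Lemma nonevasive_orbit :
  [\/ disjoint_union (complete_graph q) (empty_graph t) \in P,
      complete_bipartite q t \in P
    | exists G : graph t,
        [/\ G <> empty_graph t, cyclic_fixed G
          & disjoint_union (empty_graph q) G \in P] ].
Proof.
have [G [/set0Pn[e eG] GP Gb Gg]] := exists_affine_fixed.
have [u [v [uv eE]]] := edgeP e.
have Guv : adj G u v by rewrite (adjE _ eE).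
have cross i k : adj G (lshift t i) (rshift q k) -> complete_bipartite q t \in P.
  move=> Gik; apply: monoP GP; apply/subsetP => f.
  rewrite inE => /existsP[j /existsP[l /eqP fE]].
  by rewrite -(adjE G fE); exact: adj_cross Gik.
case: (split_ordP u) (split_ordP v) => i uE [] j vE; rewrite {u}uE {v}vE in uv eE Guv.
- apply: Or31; apply: monoP GP; apply/subsetP => f.
  rewrite inE [X in _ || X](_ : _ = false) ?orbF; last by rewrite /map_graph imset0 inE.
  case/imsetP => f' _ ->; have [k [l [kl f'E]]] := edgeP f'.
  rewrite -(@adjE _ G _ (lshift t k) (lshift t l)).
    by apply: adj_left Guv; rewrite // -(inj_eq (@lshift_inj q t)).
  by rewrite /= f'E imsetU1 imset_set1.
- by apply: Or32; exact: cross Guv.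
- by apply: Or32; rewrite adjC in Guv; exact: cross Guv.
apply: Or33; pose H : graph t := [set f | map_edge (@rshift_inj q t) f \in G].
exists H; split.
- have ij : #|[set i; j]| == 2%N by rewrite cards2 -(inj_eq (@rshift_inj q t)) uv.
  apply/eqP/set0Pn; exists (exist _ [set i; j] ij); rewrite inE.
  by rewrite -(@adjE _ G _ (rshift q i) (rshift q j)) //= imsetU1 imset_set1.
(* Rotation preserves the number of edges, so one inclusion suffices. *)
- apply/eqP; rewrite eqEcard card_imset ?leqnn ?andbT; last exact: map_edge_inj.
  apply/subsetP => _ /imsetP[f + ->]; rewrite !inE => fG.
  have -> : map_edge (@rshift_inj q t) (map_edge (@ordS_inj t) f)
      = map_edge (@perm_inj _ scale_rotate) (map_edge (@rshift_inj q t) f).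
    apply: val_inj; rewrite /= -!imset_comp; apply: eq_imset => k.
    by rewrite /= scale_rotateR.
  by rewrite -Gg mem_map_graph.
- apply: monoP GP; apply/subsetP => f.
  rewrite inE [X in X || _](_ : _ = false); last by rewrite /map_graph imset0 inE.
  by case/imsetP => f' + ->; rewrite inE.
Qed.

End Affine.

Theorem proposition4p2 (p r t : nat) (P : {set graph (p ^ r + t)}) :
  prime p -> 1 <= r -> 1 <= t -> coprime (p ^ r - 1) t ->
  graph_property P -> P <> set0 -> monotone_property P -> ~ evasive P ->
  [\/ disjoint_union (complete_graph (p ^ r)) (empty_graph t) \in P,
      complete_bipartite (p ^ r) t \in P
    | exists G : graph t,
        [/\ G <> empty_graph t, cyclic_fixed G
          & disjoint_union (empty_graph (p ^ r)) G \in P] ].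
Proof.
move=> p_pr r_gt0 _ _ isoP P0 monoP nevP.
have [F pF cardF] := pPrimePowerField p_pr r_gt0.
have [w w0 w_gen] := finField_generator F.
exact: (nonevasive_orbit pF cardF w0 isoP monoP nevP P0 w_gen).
Qed.
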